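(* Let $A$ be a finite or countably infinite alphabet, $K$ a field of characteristic zero, and $B=\{\beta_1,\beta_2,\dots\}\subseteq A^*$ a set of words each of length at least $2$. Let $G$ be a digraph on $[m]$ and $(G,P)$ a monoid network on $A^*$, with weights $w_a^{(i,j)}$ as described in the context. Then \[ \hat F_G(t_1,t_2,\dots)=\Big(I_m-\sum_{p\in P}\hat M_p-\hat L_G(t_1-1,t_2-1,\dots)\Big)^{-1}. \]
   Context: $A^*$ is the free monoid on $A$, $K\langle\langle A^*\rangle\rangle$ the algebra of formal $K$-linear combinations of words; $\mathrm{bad}_k(\gamma)$ is the number of occurrences of $\beta_k$ as a (consecutive) subword of $\gamma\in A^*$. Monoid network: $G$ is a digraph on $[m]$ with each arc $(i,j)$ assigned a set $P_{i,j}\subseteq A$; $P=\{(a,e): e=(i,j)\text{ an arc},\ a\in P_{i,j}\}$. $\overrightarrow{P^*}$ is the set of sequences $(a_1,e_1)\cdots(a_n,e_n)\in P^*$ with $e_1\cdots e_n$ a walk in $G$; $\rho$ of such a sequence is $a_1\cdots a_n$ and (for $n\ge1$) $E$ of it is the pair (initial vertex, terminal vertex) of the walk. $(G,P)$ is a monoid network if for nonempty $\alpha,\beta\in\overrightarrow{P^*}$, $\rho(\alpha)=\rho(\beta)$ and $E(\alpha)=E(\beta)$ imply $\alpha=\beta$. Weights: $\{w_a^{(i,j)}:(a,(i,j))\in P\}$ are weights commuting with each other, with the indeterminates $t_1,t_2,\dots$ and with the letters; set $w_a^{(i,j)}=0$ if $(a,(i,j))\notin P$. For $p=(a,(i,j))\in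 P$, $\hat M_p$ is the $m\times m$ matrix with $w_a^{(i,j)}a$ in entry $(i,j)$ and $0$ elsewhere. For nonempty $\alpha=(a_1,e_1)\cdots(a_n,e_n)\in\overrightarrow{P^*}$ with $E(\alpha)=(i,j)$, write $w(\alpha)=w_{a_1}^{e_1}\cdots w_{a_n}^{e_n}$ and let $\hat M_\alpha$ be the matrix with $w(\alpha)\rho(\alpha)$ in entry $(i,j)$ and $0$ elsewhere. $\hat F_G(t_1,t_2,\dots)$ is the $m\times m$ matrix whose $(i,j)$ entry is $\sum_\alpha w(\alpha)\rho(\alpha)\prod_k t_k^{\mathrm{bad}_k(\rho(\alpha))}$ over all $\alpha\in\overrightarrow{P^*}$ with $E(\alpha)=(i,j)$ (the empty sequence counting as a walk from $i$ to $i$ with weight $1$). Clusters: $\overrightarrow{B}_u=\{\alpha\in\overrightarrow{P^*}:\rho(\alpha)=\beta_u\}$, $\overrightarrow{B}=\bigcup_u\overrightarrow{B}_u$. A marked word on $\alpha\in P^*$ is $(\alpha,S)$ with $S$ a set of pairs $(i,\gamma)$, $\gamma\in\overrightarrow{B}$ occurring in $\alpha$ starting at position $i$; concatenation of marked words concatenates words and unions the (shifted) marks. A cluster on $\alpha$ is a marked word with $S\ne\emptyset$ that is not a concatenation of two marked words with nonempty underlying words; $C_\alpha$ is the set of clusters on $\alpha$ and $\mathrm{mk}_u(c)$ the number of marks $(v,\gamma)$ of $c$ with $\gamma\in\overrightarrow{B}_u$. Then \[ \hat L_G(t_1,t_2,\dots)=\sum_{\alpha\in\overrightarrow{P^*}}\hat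 M_\alpha\sum_{c\in C_\alpha}\prod_k t_k^{\mathrm{mk}_k(c)}. \] *)

(* Defs.v *)
From HB Require Import structures.
From mathcomp Require Import all_boot all_order all_algebra.
From mathcomp Require Import finmap.
From mathcomp Require Import boolp classical_sets functions cardinality fsbigop.
From mathcomp Require Import monalg.

Set Implicit Arguments.
Unset Strict Implicit.
Unset Printing Implicit Defensive.

Import GRing.Theory.

Local Open Scope fset_scope.
Local Open Scope classical_set_scope.
Local Open Scope ring_scope.

(* R<<A^*>>: a formal R-linear combination of words is its coefficient
   function. The alias hides the pointwise product that [seq A -> R] already
   carries; the product below is concatenation of words, extended linearly. *)
Definition ncseries (A : Type) (R : Type) : Type := seq A -> R.

Section NCSeries.
Variables (A : eqType) (R : comNzRingType).
Implicit Types (f g h : ncseries A R) (s : seq A).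

HB.instance Definition _ :=
  GRing.Zmodule.copy (ncseries A R) (seq A -> R).

Definition ncmonom (c : R) (s : seq A) : ncseries A R :=
  fun s' => if s' == s then c else 0.

Definition ncmul f g : ncseries A R :=
  fun s => \sum_(i < (size s).+1) f (take i s) * g (drop i s).

Let shift a f : ncseries A R := fun s => f (a :: s).

Let ncaddE f g s : (f + g) s = f s + g s. Proof. by []. Qed.

Let ncmul_nil f g : ncmul f g [::] = f [::] * g [::].
Proof. by rewrite /ncmul big_ord_recl big_ord0 addr0. Qed.

Let ncmul_cons f g a s :
  ncmul f g (a :: s) = f [::] * g (a :: s) + ncmul (shift a f) g s.
Proof. by rewrite /ncmul big_ord_recl. Qed.

Fact ncmul_addl : left_distributive ncmul +%R.
Proof.
move=> f g h; apply/funext => s; rewrite ncaddE /ncmul -big_split /=.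
by apply: eq_bigr => i _; rewrite mulrDl.
Qed.

Fact ncmul_addr : right_distributive ncmul +%R.
Proof.
move=> f g h; apply/funext => s; rewrite ncaddE /ncmul -big_split /=.
by apply: eq_bigr => i _; rewrite mulrDr.
Qed.

Let ncmul_scale (c : R) f g s :
  ncmul (fun s' => c * f s') g s = c * ncmul f g s.
Proof.
by rewrite /ncmul mulr_sumr; apply: eq_bigr => i _; rewrite mulrA.
Qed.

Fact ncmulA : associative ncmul.
Proof.
move=> f g h; apply/funext => s; elim: s f => [|a s IHs] f.
  by rewrite !ncmul_nil mulrA.
rewrite !ncmul_cons ncmul_nil IHs mulrDr mulrA -addrA; congr (_ + _).
have -> : shift a (ncmul f g) =
    ((fun s' => f [::] * shift a g s') : ncseries A R) + ncmul (shift a f) g.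
  by apply/funext => s'; rewrite ncaddE /shift ncmul_cons.
by rewrite ncmul_addl ncaddE ncmul_scale.
Qed.

Fact ncmul1 : left_id (ncmonom 1 [::]) ncmul.
Proof.
move=> f; apply/funext => s; rewrite /ncmul big_ord_recl take0 drop0.
rewrite /ncmonom eqxx mul1r big1 ?addr0 // => i _.
by case: s i => [[]//|a s i] /=; rewrite mul0r.
Qed.

Fact ncmulr1 : right_id (ncmonom 1 [::]) ncmul.
Proof.
move=> f; apply/funext => s; rewrite /ncmul big_ord_recr /= take_size drop_size.
rewrite /ncmonom eqxx mulr1 big1 ?add0r // => i _.
by rewrite -size_eq0 size_drop subn_eq0 leqNgt ltn_ord /= mulr0.
Qed.

Fact ncone_neq0 : ncmonom 1 [::] != 0 :> ncseries A R.
Proof.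
apply/eqP => /(congr1 (fun f : ncseries A R => f [::])).
by rewrite /ncmonom eqxx; apply/eqP/oner_neq0.
Qed.

HB.instance Definition _ := GRing.Zmodule_isNzRing.Build (ncseries A R)
  ncmulA ncmul1 ncmulr1 ncmul_addl ncmul_addr ncone_neq0.

(* Formal sum, over a possibly infinite index set, of matrices of series:
   every coefficient must receive finitely many nonzero contributions. *)
Definition formal_sum (m : nat) (T : choiceType) (D : set T)
    (F : T -> 'M[ncseries A R]_m) : 'M[ncseries A R]_m :=
  \matrix_(i, j) ((fun s => \sum_(x \in D) F x i j s) : ncseries A R).

End NCSeries.

(* The number of occurrences of b as a consecutive subword of s, counted by
   (0-based) starting position. *)
Definition occurs_at (T : eqType) (b s : seq T) (i : nat) : bool :=
  prefix b (drop i s).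
Definition nb_occ (T : eqType) (b s : seq T) : nat :=
  count (occurs_at b s) (iota 0 (size s).+1).

(* A pair (a, (i, j)) is the letter a on the arc from i to j. *)
Notation larc A m := (A * ('I_m * 'I_m))%type.

Section Network.
Variables (A : countType) (m : nat).
Variables (G : rel 'I_m) (P : 'I_m -> 'I_m -> set A).
Implicit Types (p : larc A m) (al : seq (larc A m)).

Definition netP : set (larc A m) :=
  [set p | G p.2.1 p.2.2 /\ P p.2.1 p.2.2 p.1].

Definition Pstar : set (seq (larc A m)) :=
  [set al | forall p, p \in al -> netP p].

Definition consecutive : rel (larc A m) := fun p q => p.2.2 == q.2.1.

Definition walks : set (seq (larc A m)) :=
  [set al | Pstar al /\ sorted consecutive al].

Definition rho al : seq A := [seq p.1 | p <- al].

(* E, undefined (None) on the empty sequence. *)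
Definition ends al : option ('I_m * 'I_m) :=
  if al is p :: al' then Some (p.2.1, (last p al').2.2) else None.

Definition walks_between (i j : 'I_m) : set (seq (larc A m)) :=
  [set al | walks al /\ if al is [::] then i = j else ends al = Some (i, j)].

Definition monoid_network : Prop :=
  forall al al', walks al -> walks al' -> al != [::] -> al' != [::] ->
    rho al = rho al' -> ends al = ends al' -> al = al'.

Section Clusters.
Variables (I : countType) (beta : I -> seq A).

Definition walksB (u : I) : set (seq (larc A m)) :=
  [set al | walks al /\ rho al = beta u].

Definition markedw : Type := seq (larc A m) * {fset nat * seq (larc A m)}.
HB.instance Definition _ := Choice.on markedw.

Definition marked_word (c : markedw) : Prop :=
  Pstar c.1 /\
  forall x, x \in c.2 ->
    (exists u, walksB u x.2) /\ occurs_at x.2 c.1 x.1.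

Definition mcat (c d : markedw) : markedw :=
  (c.1 ++ d.1, c.2 `|` [fset ((size c.1 + x.1)%N, x.2) | x in d.2])%fset.

Definition clusters al : set markedw :=
  [set c | [/\ marked_word c, c.1 = al, c.2 != fset0 &
    ~ exists d e, [/\ marked_word d, marked_word e,
        d.1 != [::], e.1 != [::] & c = mcat d e]]].

Definition mk (u : I) (c : markedw) : nat :=
  #|` [fset x in c.2 | `[< walksB u x.2 >]]|.

Variable R : comNzRingType.
Variables (w : A -> 'I_m * 'I_m -> R) (t : I -> R).

Definition weight al : R := \prod_(p <- al) w p.1 p.2.

Definition Mletter p : 'M[ncseries A R]_m :=
  \matrix_(i, j) if p.2 == (i, j) then ncmonom (w p.1 p.2) [:: p.1] else 0.

(* Only meaningful for nonempty al; the empty word carries no cluster. *)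
Definition Mword al : 'M[ncseries A R]_m :=
  \matrix_(i, j)
    if ends al == Some (i, j) then ncmonom (weight al) (rho al) else 0.

Definition tprod (e : I -> nat) : R :=
  \big[*%R/1]_(k \in [set: I]) t k ^+ e k.

Definition Fhat : 'M[ncseries A R]_m :=
  \matrix_(i, j) ((fun s => \sum_(al \in walks_between i j)
    ncmonom (weight al * tprod (fun k => nb_occ (beta k) (rho al)))
      (rho al) s) : ncseries A R).

Definition Lhat : 'M[ncseries A R]_m :=
  formal_sum walks (fun al =>
    ncmonom (\sum_(c \in clusters al) tprod (fun k => mk k c)) [::]
      *: Mword al).

End Clusters.
End Network.

(* W[t_k | k in I], with finitely or infinitely many indeterminates. *)
Notation tpoly W I := {malg W[{cmonom I}]}.
Definition tvar (W : comNzRingType) (I : choiceType) (k : I) : tpoly W I :=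
  << ucm k >>.

(* Main.v *)
(* Write t_k = 1 + x_k, so that the coefficient of a word s in the generating
   function f counts all sets of marked occurrences in s.  Cutting a marked
   word at the first position crossed by no mark leaves a single letter or a
   cluster, followed by an arbitrary marked word: f = 1 + g f, where g collects
   the letters and the clusters.  Everything happens on words of A; the network
   enters only through the matrices of weights T(s)_{ij} = sum of w(al) over the
   walks al from i to j spelling s, which satisfy T(ss') = T(s) T(s').  Hence
   h |-> (sum_s T(s)_{ij} h(s) s)_{ij} is a ring morphism from series to
   matrices of series, and it sends f to F and g to the sum of the letters and L. *)

Require Import Defs.
From HB Require Import structures.
From mathcomp Require Import all_boot all_order all_algebra.
From mathcomp Require Import finmap zify.
From mathcomp Require Import boolp classical_sets functions cardinality fsbigop.
From mathcomp Require Import monalg.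

Set Implicit Arguments.
Unset Strict Implicit.
Unset Printing Implicit Defensive.

Import GRing.Theory.

Local Open Scope classical_set_scope.
Local Open Scope ring_scope.

(** * Sets of marks on a word *)

Section Sublists.
Variable T : eqType.
Implicit Types (p : pred T) (q r : seq T).

(** Sets of marks are encoded as subsequences of a duplicate-free list: each subset arises exactly
    once, and sums over subsets follow the recursion on words. *)
Fixpoint sublists q : seq (seq T) :=
  if q is x :: q' then [seq x :: r | r <- sublists q'] ++ sublists q'
  else [:: [::]].

Lemma mem_sublists q r : (r \in sublists q) = subseq r q.
Proof.
elim: q r => [|x q IHq] r /=; first by rewrite inE; case: r.
rewrite mem_cat IHq; case: r => [|y r] /=; first by rewrite sub0seq orbT.
have [->|neq_yx] := eqVneq y x; last first.
  by rewrite orb_idl // => /mapP[r' _ [eq_yx]]; rewrite eq_yx eqxx in neq_yx.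
rewrite (mem_map (f := cons x)) ?IHq; last by move=> ? ? [].
by rewrite orb_idr // => /(subseq_trans (subseq_cons _ _)).
Qed.

Lemma sublists_uniq q : uniq q -> uniq (sublists q).
Proof.
elim: q => //= x q IHq /andP[xNq /IHq Uq].
rewrite cat_uniq map_inj_uniq ?Uq ?andbT //=; last by move=> ? ? [].
apply/hasPn => r; rewrite mem_sublists => /mem_subseq sub_rq.
by apply: contra xNq => /mapP[r' _ eq_r]; apply: sub_rq; rewrite eq_r mem_head.
Qed.

Lemma sublists_filter p q : sublists (filter p q) = filter (all p) (sublists q).
Proof.
elim: q => //= x q IHq; rewrite filter_cat filter_map.
case: ifP => px /=; rewrite IHq.
  by congr (map _ _ ++ _); apply: eq_filter => r /=; rewrite px.
rewrite (_ : filter (preim _ _) _ = [::]) //.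
by elim: (sublists q) => //= r rs ->; rewrite px.
Qed.

Lemma sum_sublists_cat (V : nmodType) q1 q2 (H : seq T -> V) :
  \sum_(r <- sublists (q1 ++ q2)) H r =
  \sum_(r1 <- sublists q1) \sum_(r2 <- sublists q2) H (r1 ++ r2).
Proof.
elim: q1 H => [|x q1 IHq] H /=; first by rewrite big_seq1.
by rewrite !big_cat !big_map !IHq.
Qed.

(** Expanding the product chooses [1] or [F x] for each entry; this is how writing t = 1 + x
    produces all sets of marks. *)
Lemma sum_sublists_prod (R : comNzRingType) q (F : T -> R) :
  \sum_(r <- sublists q) \prod_(x <- r) F x = \prod_(x <- q) (1 + F x).
Proof.
elim: q => [|x q IHq] /=; first by rewrite big_seq1 !big_nil.
rewrite big_cat big_map big_cons mulrDl mul1r addrC -IHq mulr_sumr.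
by congr (_ + _); apply: eq_bigr => r _; rewrite big_cons.
Qed.

End Sublists.

Lemma sublists_map (T U : eqType) (h : T -> U) q :
  sublists (map h q) = map (map h) (sublists q).
Proof.
by elim: q => //= x q ->; rewrite map_cat -!map_comp.
Qed.

(* A mark on a word is recorded as a pair (start, length). *)
Section Marks.
Variable T : eqType.
Implicit Types (s : seq T) (x : nat * nat) (r : seq (nat * nat)).

Definition factor s x : seq T := take x.2 (drop x.1 s).

Definition shift_mark k x : nat * nat := ((k + x.1)%N, x.2).

(** Position k is the gap between letters k-1 and k, counted from 0; a crossing mark covers both of
    these letters. *)
Definition crosses k x : bool := (x.1 < k < x.1 + x.2)%N.

(** The positions tested are the interior gaps of a word of length n, so the condition is vacuous
    for n at most 1. *)
Definition connected n r : bool :=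
  all (fun k => has (crosses k) r) (iota 1 n.-1).

Variable B : pred (seq T).

Definition initial_marks s : seq (nat * nat) :=
  [seq (0%N, n) | n <- iota 1 (size s) & B (take n s)].

Fixpoint marks s : seq (nat * nat) :=
  if s is _ :: s' then initial_marks s ++ map (shift_mark 1) (marks s')
  else [::].

Lemma shift_mark_inj k : injective (shift_mark k).
Proof. by move=> [i n] [j l] [/addnI -> ->]. Qed.

Lemma mem_marks s x :
  (x \in marks s) = [&& 0 < x.2, x.1 + x.2 <= size s & B (factor s x)]%N.
Proof.
elim: s x => [|a s IHs] [i n]; first by rewrite in_nil /=; lia.
rewrite /= mem_cat; case: i => [|i].
  rewrite [X in _ || X](_ : _ = false); last first.
    by apply/negbTE/mapP => -[[i' n'] _ []].
  rewrite orbF mem_map; last by move=> ? ? [].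
  rewrite mem_filter mem_iota /factor drop0 add0n add1n ltnS.
  by rewrite andbC andbA.
rewrite [X in X || _](_ : _ = false); last by apply/negbTE/mapP => -[n' _ []].
by rewrite /= -[(i.+1, n)]/(shift_mark 1 (i, n))
  (mem_map (@shift_mark_inj 1)) IHs.
Qed.

Lemma marks_uniq s : uniq (marks s).
Proof.
elim: s => // a s IHs; rewrite /= cat_uniq (map_inj_uniq (@shift_mark_inj 1)) IHs.
rewrite andbT map_inj_uniq ?filter_uniq ?iota_uniq //=; last by move=> ? ? [].
by apply/hasPn => _ /mapP[x _ ->]; apply/mapP => -[].
Qed.

(** A mark starting at 0 avoids position [k.+1] exactly when its length is at most [k.+1], that is,
    when it fits in the prefix. *)
Lemma filter_initial_marks k s : (k <= size s)%N ->
  filter (predC (crosses k.+1)) (initial_marks s) = initial_marks (take k.+1 s).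
Proof.
move=> le_ks; rewrite filter_map -filter_predI; congr map.
rewrite size_take_min.
have -> : iota 1 (size s) =
    iota 1 (minn k.+1 (size s)) ++ iota k.+2 (size s - k.+1).
  have [lt_ks|ge_ks] := leqP k.+1 (size s).
    by rewrite -{1}(subnKC lt_ks) iotaD.
  by rewrite (eqP (ltnW ge_ks)) cats0.
rewrite filter_cat [X in _ ++ X](_ : _ = [::]) ?cats0.
  apply: eq_in_filter => n; rewrite mem_iota => n_le.
  rewrite take_takel; last by lia.
  by rewrite /= /crosses /=; case: (B _); rewrite ?andbT ?andbF //=; lia.
apply/eqP; rewrite -[_ == _]negbK -has_filter; apply/hasPn => n.
by rewrite mem_iota /crosses /=; case: (B _); rewrite ?andbF ?andbT //=; lia.
Qed.

(** A mark avoiding k ends by k or starts at k or later. Since [marks] is ordered by starting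
    position, this is an equality of lists, to which [sum_sublists_cat] applies. *)
Lemma filter_marks k s : (k <= size s)%N ->
  filter (predC (crosses k)) (marks s) =
  marks (take k s) ++ map (shift_mark k) (marks (drop k s)).
Proof.
elim: s k => [|a s IHs] [|k] // le_ks.
  rewrite take0 drop0 cat0s (eq_filter (a2 := predT)) ?filter_predT //.
  by rewrite (eq_map (g := id)) ?map_id // => -[].
rewrite /= filter_cat -catA filter_initial_marks 1?ltnW //; congr (_ ++ _).
rewrite filter_map.
rewrite (eq_map (f := shift_mark k.+1) (g := shift_mark 1 \o shift_mark k)) //.
rewrite map_comp -map_cat -IHs //; congr map.
Qed.

End Marks.

(** * Series with constant coefficient 1 *)

Section SeriesFacts.
Variables (A : eqType) (R : comNzRingType).
Implicit Types (d f g : ncseries A R) (s : seq A).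

Lemma ncaddE f g s : (f + g) s = f s + g s.
Proof. by []. Qed.

Lemma ncoppE f s : (- f) s = - f s.
Proof. by []. Qed.

Lemma nconeE s : (1 : ncseries A R) s = (s == [::])%:R.
Proof. by rewrite -[1]/(ncmonom 1 [::]) /ncmonom; case: eqP. Qed.

Lemma ncmulE f g s :
  (f * g) s = \sum_(i < (size s).+1) f (take i s) * g (drop i s).
Proof. by []. Qed.

Lemma ncmonom_nil_mul (c : R) f s :
  (ncmonom c [::] * f) s = c * f s.
Proof.
rewrite ncmulE big_ord_recl take0 drop0 /ncmonom eqxx big1 ?addr0 // => i _.
by case: s i => [[]//|a s i] /=; rewrite mul0r.
Qed.

(** Strong induction on the length of s: the coefficient of s in [d * f] is [d s] plus terms
    involving d on strictly shorter prefixes. *)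
Lemma ncmul_eq0_unipotent d f : f [::] = 1 -> d * f = 0 -> d = 0.
Proof.
move=> f1 df0; apply/funext => s.
have [n le_sn] := ubnP (size s); elim: n s le_sn => // n IHn s le_sn.
have := congr1 (fun e : ncseries A R => e s) df0.
rewrite ncmulE big_ord_recr /= take_size drop_size f1 mulr1 big1 ?add0r // => i _.
by rewrite IHn ?mul0r // size_take ltn_ord; apply: leq_trans (ltn_ord i) _.
Qed.

(** Here (fd - 1)f = f(df) - f = 0, and f can be cancelled on the right. *)
Lemma unipotent_left_inverse d f : f [::] = 1 -> d * f = 1 -> f * d = 1.
Proof.
move=> f1 df1; apply/eqP; rewrite -subr_eq0; apply/eqP.
by apply: (ncmul_eq0_unipotent f1); rewrite mulrBl -mulrA df1 mulr1 mul1r subrr.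
Qed.

End SeriesFacts.

(** * Decomposition of marked words at the first gap *)

Section WordClusters.
Variables (A : eqType) (R : comNzRingType) (B : pred (seq A)) (y : seq A -> R).
Implicit Types (s : seq A) (r : seq (nat * nat)).

Definition mark_weight s r : R := \prod_(x <- r) y (factor s x).

(** By [sum_sublists_prod] this is the sum over all sets of marks; the product form becomes a
    monomial in the t's once y = t - 1. *)
Definition marked_gf : ncseries A R :=
  fun s => \prod_(x <- marks B s) (1 + y (factor s x)).

(* The empty set of marks is connected on a one-letter word, so this series
   gathers the single letters and the clusters. *)
Definition connected_gf : ncseries A R := fun s =>
  if s is [::] then 0 else
    \sum_(r <- sublists (marks B s) | connected (size s) r) mark_weight s r.

Lemma connected_gfE s : s != [::] -> connected_gf s =
  \sum_(r <- sublists (marks B s) | connected (size s) r) mark_weight s r.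
Proof. by case: s. Qed.

(* The least uncrossed position is [(first_gap n r).+1]. *)
Definition first_gap n r : nat :=
  find (fun k => ~~ has (crosses k) r) (iota 1 n).

(** Connectedness of length [k.+1] concerns positions 1 to k only, so it says exactly that no
    earlier position is uncrossed. *)
Lemma first_gapE n r k : (k < n)%N ->
  (first_gap n r == k) = connected k.+1 r && all (predC (crosses k.+1)) r.
Proof.
move=> lt_kn; rewrite all_predC /connected /=; set p := fun j => has _ _.
rewrite /first_gap -/p.
have -> : iota 1 n = iota 1 k ++ k.+1 :: iota k.+2 (n - k.+1).
  by rewrite [in LHS](_ : n = k + (n - k.+1).+1)%N ?iotaD ?add1n //; lia.
rewrite find_cat size_iota /= -/(p k.+1).
have [/hasP[j j_in pj]|/hasPn noj] := boolP (has _ _).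
  rewrite [all _ _](_ : _ = false); last first.
    by apply/negbTE/allPn; exists j.
  apply/negbTE; rewrite neq_ltn; apply/orP; left.
  have: has (fun j => ~~ p j) (iota 1 k) by apply/hasP; exists j.
  by rewrite has_find size_iota.
rewrite (_ : all _ _) /=; last by apply/allP => j /noj; rewrite negbK.
by case: (p k.+1); rewrite /= ?addn0 ?eqxx //; lia.
Qed.

(** Marks shifted by k start at k or later, so they cross no position below k. *)
Lemma connected_cat_shift k r1 r2 :
  connected k (r1 ++ map (shift_mark k) r2) = connected k r1.
Proof.
apply: eq_in_all => j; rewrite mem_iota => j_lt; rewrite has_cat has_map.
rewrite [X in _ || X](_ : _ = false) ?orbF //; apply/hasPn => x _ /=.
by rewrite /crosses /=; lia.
Qed.

Lemma factor_shift s k x : factor s (shift_mark k x) = factor (drop k s) x.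
Proof. by rewrite /factor drop_drop addnC. Qed.

Lemma factor_take s k x :
  (x.1 + x.2 <= k)%N -> factor (take k s) x = factor s x.
Proof. by move=> le_xk; rewrite /factor !take_drop take_takel //; lia. Qed.

(* The marks avoiding position k.+1 split into those of the two factors; the
   second factor carries an arbitrary set of marks. *)
Lemma sum_gap_at s k : (k < size s)%N ->
  \sum_(r <- sublists (marks B s) |
        connected k.+1 r && all (predC (crosses k.+1)) r) mark_weight s r =
  connected_gf (take k.+1 s) * marked_gf (drop k.+1 s).
Proof.
move=> lt_ks; under eq_bigl do rewrite andbC.
(* The condition on the set of marks becomes a restriction on the marks available, whose list then
   splits in two. *)
rewrite big_mkcondr -big_filter -sublists_filter filter_marks //.
have size_take_s : size (take k.+1 s) = k.+1 by rewrite size_takel.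
rewrite sum_sublists_cat connected_gfE -?size_eq0 size_take_s //.
rewrite /marked_gf -sum_sublists_prod big_distrl /=.
rewrite [RHS]big_mkcond /=; apply: eq_big_seq => r1.
rewrite mem_sublists => /mem_subseq sub_r1.
rewrite sublists_map big_map.
under eq_bigr do rewrite connected_cat_shift.
case: ifP => _; last by rewrite big1.
rewrite mulr_sumr; apply: eq_bigr => r2 _.
rewrite /mark_weight big_cat big_map; congr (_ * _); last first.
  by apply: eq_bigr => x _; rewrite factor_shift.
apply: eq_big_seq => x /sub_r1; rewrite mem_marks size_take_s => /and3P[_ le_x _].
by rewrite factor_take.
Qed.

(** The sets of marks are classified by their first uncrossed position, and [sum_gap_at] evaluates
    each class. *)
Lemma marked_gf_rec s : s != [::] ->
  marked_gf s =
  \sum_(k < size s) connected_gf (take k.+1 s) * marked_gf (drop k.+1 s).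
Proof.
case: s => // a s _; rewrite {1}/marked_gf -sum_sublists_prod big_seq.
pose gap r : 'I_(size s).+1 := inord (first_gap (size (a :: s)) r).
rewrite (partition_big gap xpredT) //.
apply: eq_bigr => k _; rewrite -(@sum_gap_at (a :: s)) // [RHS]big_seq_cond.
apply: eq_bigl => r; apply: andb_id2l.
rewrite mem_sublists => /mem_subseq sub_r.
rewrite -(@first_gapE (size s).+1) // -val_eqE /gap /= inordK //.
(* No mark crosses the end of the word, so a gap always exists and [inord] never falls back to its
   default. *)
rewrite -[X in (_ < X)%N](size_iota 1) -has_find.
apply/hasP; exists (size s).+1; first by rewrite mem_iota; lia.
apply/hasPn => x /sub_r; rewrite mem_marks /crosses /= => /and3P[_ le_x _].
by lia.
Qed.

Lemma marked_gf_nil : marked_gf [::] = 1.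
Proof. by rewrite /marked_gf big_nil. Qed.

Lemma marked_connectedE : (1 - connected_gf) * marked_gf = 1.
Proof.
apply/eqP; rewrite mulrBl mul1r subr_eq addrC eq_sym; apply/eqP/funext => s.
(* The empty prefix contributes nothing because [connected_gf] vanishes there; the other terms are
   those of [marked_gf_rec]. *)
rewrite ncaddE ncmulE big_ord_recl take0 mul0r add0r nconeE.
have [->|s_nil] := eqVneq s [::].
  by rewrite big_ord0 marked_gf_nil add0r.
by rewrite addr0 [RHS]marked_gf_rec.
Qed.

End WordClusters.

(** * Matrices of weights *)

Lemma ncsumE (A : eqType) (R : comNzRingType) (J : Type) (r : seq J)
    (F : J -> ncseries A R) s :
  (\sum_(j <- r) F j) s = \sum_(j <- r) F j s.
Proof. exact: (big_morph (fun f : ncseries A R => f s)). Qed.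

(** The list r and the domain D may differ in both directions, as long as the terms are neutral
    where they do. This allows enumerations that ignore membership in the network. *)
Lemma fsbig_seq_support (R : Type) (idx : R) (op : Monoid.com_law idx)
    (T : choiceType) (D : set T) (r : seq T) (F : T -> R) :
    uniq r -> (forall x, x \in r -> ~ D x -> F x = idx) ->
    (forall x, D x -> x \notin r -> F x = idx) ->
  \big[op/idx]_(x \in D) F x = \big[op/idx]_(x <- r) F x.
Proof.
move=> Ur FrD FDr.
rewrite (fsbigE (filter [pred x | `[< D x >]] r)) ?filter_uniq //; first last.
- by move=> x Dx; rewrite mem_filter /= asboolT // => /FDr ->.
- by move=> x /=; rewrite mem_filter => /andP[/asboolP].
rewrite big_filter_cond big_mkcond; apply: eq_big_seq => x xr /=.
case: asboolP => [Dx|nDx]; first by rewrite mem_set.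
by rewrite FrD.
Qed.

Arguments fsbig_seq_support {R idx op T D} r {F}.

Section Transfer.
Variables (A : eqType) (R : comNzRingType) (m : nat).
Variable w : A -> 'I_m * 'I_m -> R.
Implicit Types (f g : ncseries A R) (s : seq A).

(** The matrix T(s): expanding the matrix product runs over the intermediate vertices of a walk
    spelling s. *)
Fixpoint word_mx s : 'M[R]_m :=
  if s is a :: s' then (\matrix_(i, j) w a (i, j)) *m word_mx s' else 1%:M.

Lemma word_mx_cat s1 s2 : word_mx (s1 ++ s2) = word_mx s1 *m word_mx s2.
Proof. by elim: s1 => [|a s1 IHs] /=; rewrite ?mul1mx // IHs mulmxA. Qed.

(* [transfer] takes the Hadamard product with the coefficients of a matrix
   representation of the free monoid, hence is a ring morphism. *)
Definition transfer f : 'M[ncseries A R]_m :=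
  \matrix_(i, j) ((fun s => word_mx s i j * f s) : ncseries A R).

Lemma transferB f g : transfer (f - g) = transfer f - transfer g.
Proof.
apply/matrixP => i j; rewrite !mxE; apply/funext => s.
by rewrite ncaddE ncoppE [RHS]ncaddE ncoppE mulrBr.
Qed.

Lemma transfer1 : transfer 1 = 1%:M.
Proof.
apply/matrixP => i j; rewrite !mxE; apply/funext => s; rewrite nconeE.
case: s => [|a s] /=; rewrite ?mulr0 ?mulr1 ?mxE.
  by case: (i == j); rewrite ?mulr1n ?mulr0n ?nconeE.
by case: (i == j); rewrite ?mulr1n ?mulr0n ?nconeE.
Qed.

(** At each cut of s, multiplicativity of [word_mx] supplies the sum over the intermediate index. *)
Lemma transferM f g : transfer (f * g) = transfer f *m transfer g.
Proof.
apply/matrixP => i j; rewrite !mxE; apply/funext => s.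
rewrite ncmulE ncsumE mulr_sumr; under [RHS]eq_bigr do rewrite ncmulE.
rewrite exchange_big /=; apply: eq_bigr => k _.
rewrite -{1}(cat_take_drop k s) word_mx_cat mxE mulr_suml; apply: eq_bigr => l _.
by rewrite !mxE mulrACA.
Qed.

End Transfer.

(** * Sums over walks spelling a word *)

Section WalkSums.
Variables (A : countType) (R : comNzRingType) (m : nat).
Variables (G : rel 'I_m) (P : 'I_m -> 'I_m -> set A).
Variable w : A -> 'I_m * 'I_m -> R.
Hypothesis w_out : forall a e, ~ netP G P (a, e) -> w a e = 0.
Implicit Types (s : seq A) (al : seq (larc A m)).

(** All vertex choices are allowed, whether or not the arcs belong to the network: the list is
    finite, and illegal lifts have weight 0 by [w_out]. *)
Fixpoint lifts (i j : 'I_m) s : seq (seq (larc A m)) :=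
  if s is a :: s' then
    flatten [seq [seq (a, (i, k)) :: al | al <- lifts k j s'] | k <- enum 'I_m]
  else if i == j then [:: [::]] else [::].

Definition path_between (i j : 'I_m) al : bool :=
  if al is p :: al' then
    [&& path (@consecutive A m) p al', p.2.1 == i & (last p al').2.2 == j]
  else i == j.

Lemma walks_betweenE i j al :
  walks_between G P i j al <-> Pstar G P al /\ path_between i j al.
Proof.
case: al => [|p al] /=.
  by split=> [[[Pal _] ->]|[Pal /eqP]].
split=> [[[Pal con] [<- <-]]|[Pal /and3P[con /eqP<- /eqP<-]]].
  by rewrite [path _ _ _]con !eqxx.
by [].
Qed.

Lemma path_between_cons i j p al :
  path_between i j (p :: al) = (p.2.1 == i) && path_between p.2.2 j al.
Proof.
case: al => [|q al] //=; rewrite /consecutive [q.2.1 == _]eq_sym.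
by case: eqP => //= _; rewrite ?andbF //= andbCA.
Qed.

Lemma mem_lifts i j s al :
  (al \in lifts i j s) = (rho al == s) && path_between i j al.
Proof.
elim: s i al => [|a s IHs] i al /=.
  by case: al => [|p al] /=; case: eqP => //= _; rewrite ?inE.
apply/flatten_mapP/idP => [[k _ /mapP[al' + ->]]|].
  rewrite IHs => /andP[/eqP rho_al' pb].
  by rewrite path_between_cons /= rho_al' !eqxx.
case: al => [|[b [i' k]] al] //; rewrite path_between_cons /= eqseq_cons.
move=> /andP[/andP[/eqP-> rho_al] /andP[/eqP-> pb]].
exists k; first by rewrite mem_enum.
by apply/mapP; exists al; rewrite ?IHs ?rho_al.
Qed.

Lemma lifts_uniq i j s : uniq (lifts i j s).
Proof.
elim: s i => [|a s IHs] i /=; first by case: (i == j).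
apply: allpairs_uniq_dep => //; first exact: enum_uniq.
by move=> [k al] [k' al'] _ _ [-> ->].
Qed.

Lemma weight_out al : ~ Pstar G P al -> weight w al = 0.
Proof.
move=> nPal; have [p p_al nPp] : exists2 p, p \in al & ~ netP G P p.
  apply: contrapT => noP; apply: nPal => p p_al; apply: contrapT => nPp.
  by apply: noP; exists p.
rewrite /weight; elim: al p_al {nPal} => // q al IHal; rewrite inE big_cons.
case/predU1P => [<-|/IHal ->]; last by rewrite mulr0.
by rewrite w_out ?mul0r // -surjective_pairing.
Qed.

Lemma sum_lifts_weight i j s :
  \sum_(al <- lifts i j s) weight w al = word_mx w s i j.
Proof.
elim: s i => [|a s IHs] i /=.
  by rewrite mxE; case: eqP; rewrite ?big_nil // big_seq1 /weight big_nil.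
rewrite big_allpairs_dep mxE big_enum /=; apply: eq_bigr => k _.
rewrite mxE -IHs mulr_sumr.
by apply: eq_bigr => al _; rewrite /weight big_cons.
Qed.

(** Only walks spelling s contribute to its coefficient, and all of them lie in [lifts i j s]; [phi]
    depends on the word alone and factors out. *)
Lemma sum_walks_between (phi : seq A -> R) i j s :
  \sum_(al \in walks_between G P i j)
     ncmonom (weight w al * phi (rho al)) (rho al) s
  = word_mx w s i j * phi s.
Proof.
rewrite (fsbig_seq_support (lifts i j s)) ?lifts_uniq //; first last.
- move=> al /walks_betweenE[_ pb]; rewrite mem_lifts pb andbT /ncmonom eq_sym.
  by move=> /negbTE ->.
- move=> al; rewrite mem_lifts => /andP[_ pb] nwalk.
  rewrite /ncmonom weight_out ?mul0r ?if_same // => Pal.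
  by apply: nwalk; apply/walks_betweenE.
rewrite -sum_lifts_weight mulr_suml; apply: eq_big_seq => al.
by rewrite mem_lifts => /andP[/eqP-> _]; rewrite /ncmonom eqxx.
Qed.

Lemma sum_letters :
  formal_sum (netP G P) (Mletter w) = transfer w (fun s => (size s == 1%N)%:R).
Proof.
apply/matrixP => i j; rewrite !mxE; apply/funext => s.
case: s => [|a [|b s]] /=.
- by rewrite mulr0 fsbig1 // => p _; rewrite mxE; case: ifP.
- rewrite mulr1 mulmx1 mxE (fsbig_seq_support [:: (a, (i, j))]) //.
  + by rewrite big_seq1 mxE eqxx /ncmonom eqxx.
  + move=> p; rewrite inE => /eqP-> nPp; rewrite mxE eqxx /ncmonom eqxx.
    exact: w_out.
  + move=> [b e] _; rewrite inE mxE xpair_eqE /= => neq_p; case: eqP => // eq_e.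
    rewrite eq_e eqxx andbT in neq_p.
    by rewrite /ncmonom eqseq_cons [a == b]eq_sym (negbTE neq_p).
- rewrite mulr0 fsbig1 // => p _; rewrite mxE; case: ifP => // _.
  by rewrite /ncmonom !eqseq_cons andbF.
Qed.

End WalkSums.

(** * Patterns and clusters *)

Lemma occurs_atE (T : eqType) (b s : seq T) i :
  occurs_at b s i = (factor s (i, size b) == b).
Proof. by rewrite /occurs_at prefixE. Qed.

Lemma nb_occ_cons (T : eqType) (b : seq T) a s :
  nb_occ b (a :: s) = (prefix b (a :: s) + nb_occ b s)%N.
Proof.
have def_iota : iota 0 (size (a :: s)).+1 = 0%N :: map S (iota 0 (size s).+1).
  by rewrite -(iotaDl 1 0).
by rewrite /nb_occ def_iota [count _ (_ :: _)]/= /occurs_at count_map.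
Qed.

Lemma size_factor (T : eqType) (s : seq T) x :
  (x.1 + x.2 <= size s)%N -> size (factor s x) = x.2.
Proof. by move=> le_x; rewrite size_takel // size_drop; lia. Qed.

(** Past the end of s, [drop] returns the empty word, which has no nonempty prefix. *)
Lemma occurs_at_le (T : eqType) (b s : seq T) i :
  (0 < size b)%N -> occurs_at b s i -> (i + size b <= size s)%N.
Proof.
by move=> b_gt0 /prefixP[b' /(congr1 size)]; rewrite size_drop size_cat; lia.
Qed.

Section Index.
Variables (A : countType) (I : countType) (beta : I -> seq A).
Hypothesis beta_inj : injective beta.
Hypothesis beta_size : forall k, (2 <= size (beta k))%N.
Implicit Types (b s : seq A).

(** The index type may be infinite, so the index comes from classical choice; injectivity of [beta]
    makes it unique. *)
Definition word_index b : option I :=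
  if pselect (exists u, beta u = b) is left h then Some (sval (cid h))
  else None.

Lemma word_indexE b u : (word_index b == Some u) = (b == beta u).
Proof.
rewrite /word_index; case: pselect => [h|nh].
  by case: cid => v /= eq_v; rewrite -eq_v (inj_eq beta_inj) (inj_eq Some_inj).
by apply/esym/negbTE/eqP => eq_b; apply: nh; exists u.
Qed.

Definition is_pattern b : bool := word_index b.

Lemma is_patternP b : reflect (exists u, beta u = b) (is_pattern b).
Proof.
rewrite /is_pattern; case def_b: (word_index b) => [u|]; constructor.
  by exists u; apply/esym/eqP; rewrite -word_indexE def_b.
by case=> u /esym/eqP; rewrite -word_indexE def_b.
Qed.

(** A mark at 0 spelling [beta k] must have the length of [beta k], so at most one is counted. *)
Lemma count_initial_marks k s :
  count (pred1 (beta k)) (map (factor s) (initial_marks is_pattern s)) =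
  prefix (beta k) s.
Proof.
have beta_gt0 : (0 < size (beta k))%N by apply: leq_trans (beta_size k).
rewrite -map_comp count_map count_filter.
rewrite (eq_in_count
  (a2 := fun n => (n == size (beta k)) && prefix (beta k) s));
    last first.
  move=> n; rewrite mem_iota => n_le; rewrite /= /factor drop0.
  rewrite prefixE; apply/andP/andP => [[/eqP eq_b _]|[/eqP-> /eqP eq_b]].
    have le_ns : (n <= size s)%N by case/andP: n_le.
    by rewrite -eq_b size_takel ?eqxx.
  by rewrite eq_b eqxx; split=> //; apply/is_patternP; exists k.
case: (boolP (prefix _ _)) => [pref|_]; last first.
  by rewrite (eq_count (a2 := pred0)) ?count_pred0 // => n; rewrite andbF.
rewrite (eq_count (a2 := pred1 (size (beta k)))); last first.
  by move=> n; rewrite andbT.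
rewrite count_uniq_mem ?iota_uniq // mem_iota beta_gt0 /= add1n ltnS.
by rewrite size_prefix.
Qed.

Lemma count_pattern_marks k s :
  count (pred1 (beta k)) (map (factor s) (marks is_pattern s)) =
  nb_occ (beta k) s.
Proof.
elim: s => [|a s IHs].
  (* [nb_occ] also tests the position at the end of the word, where a nonempty pattern does not
     occur. *)
  by have := beta_size k; rewrite /nb_occ /= /occurs_at prefixE; case: (beta k).
rewrite nb_occ_cons -IHs map_cat count_cat count_initial_marks; congr (_ + _)%N.
by rewrite -map_comp; congr count; apply: eq_map => x; rewrite /= factor_shift drop1.
Qed.

Variable R : comNzRingType.
Variable t : I -> R.

(** The default 1 lets words outside the pattern set drop out of products, as [tprod_words]
    requires. *)
Definition pattern_weight b : R := oapp t 1 (word_index b).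

(** Only indices of words in [bs] have a nonzero exponent, so the product over I is finite; it
    groups equal factors. *)
Lemma tprod_words (e : I -> nat) (bs : seq (seq A)) :
    (forall k, e k = count (pred1 (beta k)) bs) ->
  tprod t e = \prod_(b <- bs) pattern_weight b.
Proof.
move=> eE; pose l := pmap word_index bs.
have eE' k : e k = count_mem k l.
  rewrite eE /l; elim: bs {eE l} => //= b bs ->; rewrite -word_indexE.
  by case: (word_index b) => [u|] //=.
rewrite /tprod (fsbig_seq_support (undup l)) ?undup_uniq //; first last.
- by move=> k _; rewrite mem_undup eE' => /count_memPn ->.
- by move=> k _ [].
under eq_bigr do rewrite eE'.
rewrite prodr_undup_exp_count /l.
elim: bs {eE eE' l} => [|b bs IHbs]; first by rewrite !big_nil.
rewrite big_cons -IHbs /pattern_weight /=.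
by case: (word_index b) => [u|] /=; rewrite ?big_cons ?mul1r.
Qed.

End Index.

Lemma marked_gf_patterns (A I : countType) (beta : I -> seq A)
    (R : comNzRingType) (t : I -> R) s :
    injective beta -> (forall k, 2 <= size (beta k))%N ->
  marked_gf (is_pattern beta) (pattern_weight beta (fun k => t k - 1)) s =
  tprod t (fun k => nb_occ (beta k) s).
Proof.
move=> beta_inj beta_size.
rewrite (tprod_words beta_inj t
  (bs := map (factor s) (marks (is_pattern beta) s))); last first.
  by move=> k; rewrite count_pattern_marks.
rewrite big_map; apply: eq_big_seq => x; rewrite mem_marks => /and3P[_ _].
rewrite /is_pattern /pattern_weight; case: word_index => //= u _.
by rewrite addrC subrK.
Qed.

(** * Clusters on a fixed walk *)

Section WalkClusters.
Variables (A : countType) (m : nat).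
Variables (G : rel 'I_m) (P : 'I_m -> 'I_m -> set A).
Variables (I : countType) (beta : I -> seq A).
Hypothesis beta_inj : injective beta.
Hypothesis beta_size : forall k, (2 <= size (beta k))%N.
Implicit Types (al : seq (larc A m)) (r : seq (nat * nat)).

Lemma walksB_size u al : walksB G P beta u al -> (2 <= size al)%N.
Proof. by case=> _ rho_al; rewrite -(size_map fst) [map _ _]rho_al. Qed.

Lemma marked_mark_le (c : markedw A m) z :
  marked_word G P beta c -> z \in c.2 -> (z.1 + size z.2 <= size c.1)%N.
Proof.
move=> [_ /[apply] -[[u /walksB_size ge2]]]; apply: occurs_at_le.
exact: leq_trans ge2.
Qed.

(** In a concatenation no mark crosses the junction. Conversely, at an uncrossed position each mark
    lies on one side, and the marks can be shared out between the two factors. *)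
Lemma decomposableP (c : markedw A m) : marked_word G P beta c ->
  (exists d e, [/\ marked_word G P beta d, marked_word G P beta e,
        d.1 != [::], e.1 != [::] & c = mcat d e]) <->
  (exists2 k, (0 < k < size c.1)%N &
     forall z, z \in c.2 -> ~~ crosses k (z.1, size z.2)).
Proof.
case: c => al F mw; split=> /=.
  move=> [d [e [mwd mwe d0 e0 [-> ->]]]]; exists (size d.1).
    rewrite size_cat; move: d0 e0; rewrite -!size_eq0 -!lt0n => -> e_gt0.
    by rewrite -addn1 leq_add2l.
  move=> z; rewrite in_fsetU => /orP[zd|/imfsetP[y /= _ ->]].
    by have := marked_mark_le mwd zd; rewrite /crosses /=; lia.
  by rewrite /crosses /=; lia.
move=> [k k_lt noc]; have [PF markF] := mw.
pose d : markedw A m := (take k al, [fset z in F | (z.1 + size z.2 <= k)%N]%fset).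
pose e : markedw A m := (drop k al,
  [fset ((z.1 - k)%N, z.2) | z in [fset z in F | (k <= z.1)%N]]%fset).
have size_d : size (take k al) = k by rewrite size_takel //; lia.
exists d, e; split.
- split=> [p /mem_take/PF //|z]; rewrite !inE /= => /andP[/markF[Bz occ] le_zk].
  by split=> //; move: occ; rewrite !occurs_atE factor_take.
- split=> [p /mem_drop/PF //|y /imfsetP[z /=]]; rewrite !inE /=.
  move=> /andP[/markF[Bz occ] le_kz] ->; split=> //=.
  by move: occ; rewrite !occurs_atE -factor_shift /shift_mark /= subnKC.
- by rewrite -size_eq0 -lt0n size_d; case/andP: k_lt.
- by rewrite -size_eq0 -lt0n size_drop subn_gt0; case/andP: k_lt.
rewrite /mcat /= cat_take_drop size_d; congr pair; apply/fsetP => z.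
rewrite in_fsetU !inE; apply/idP/orP => [zF|[/andP[]//|]].
  have [le_zk|gt_zk] := leqP (z.1 + size z.2) k; first by left; rewrite zF.
  have le_kz : (k <= z.1)%N.
    by have := noc z zF; rewrite /crosses gt_zk andbT -leqNgt.
  right.
  apply/imfsetP; exists ((z.1 - k)%N, z.2); rewrite /= ?subnKC -?surjective_pairing //.
  by apply/imfsetP; exists z => //=; rewrite !inE zF.
move=> /imfsetP[_ /imfsetP[y + ->] ->] /=; rewrite !inE /= => /andP[yF le_ky].
by rewrite subnKC // -surjective_pairing.
Qed.

Section FixedWalk.
Variable al : seq (larc A m).
Hypothesis walk_al : walks G P al.

Definition walk_marks := marks (is_pattern beta) (rho al).

(** A mark in the sense of [marked_word] carries a subwalk, which on a fixed walk is determined by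
    start and length. *)
Definition embed_mark (x : nat * nat) : nat * seq (larc A m) :=
  (x.1, factor al x).

Definition cluster_of r : markedw A m :=
  (al, [fset z in map embed_mark r]%fset).

Lemma rho_factor x : rho (factor al x) = factor (rho al) x.
Proof. by rewrite /rho /factor map_take map_drop. Qed.

Lemma walks_factor x : walks G P (factor al x).
Proof.
have [Pal con] := walk_al; split.
  by move=> p /mem_take/mem_drop/Pal.
by apply: take_sorted; apply: drop_sorted.
Qed.

Lemma mem_walk_marks x : x \in walk_marks ->
  (x.1 + x.2 <= size al)%N /\ exists u, beta u = factor (rho al) x.
Proof.
rewrite mem_marks size_map => /and3P[_ le_x /(is_patternP beta_inj) pat].
by split.
Qed.

Lemma embed_mark_inj : {in walk_marks &, injective embed_mark}.
Proof.
move=> [i n] [j l] /mem_walk_marks[le_x _] /mem_walk_marks[le_y _] [eq_i eq_f].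
by have := congr1 size eq_f; rewrite !size_factor //= eq_i => ->.
Qed.

Lemma marked_word_cluster_of r :
  {subset r <= walk_marks} -> marked_word G P beta (cluster_of r).
Proof.
have [Pal _] := walk_al; move=> sub_r; split=> // z; rewrite inE /=.
move=> /mapP[x /sub_r /mem_walk_marks[le_x [u beta_u]] ->]; split=> /=.
  by exists u; split; [exact: walks_factor|rewrite rho_factor].
by rewrite occurs_atE size_factor // -surjective_pairing.
Qed.

Lemma marked_word_marks (c : markedw A m) z :
    marked_word G P beta c -> c.1 = al -> z \in c.2 ->
  (z.1, size z.2) \in walk_marks /\ z = embed_mark (z.1, size z.2).
Proof.
move=> mw def_al zc; have le_z := marked_mark_le mw zc.
have [_ /(_ z zc)[[u Bz]]] := mw; have ge2 := walksB_size Bz.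
have [_ rho_z] := Bz; rewrite def_al occurs_atE => /eqP fac.
split; last by rewrite /embed_mark fac -surjective_pairing.
rewrite mem_marks size_map -rho_factor fac -def_al le_z /=.
by rewrite (ltnW ge2); apply/(is_patternP beta_inj); exists u.
Qed.

(** Indecomposability is connectedness by [decomposableP]. The empty set of marks, connected on very
    short walks, is excluded separately. *)
Lemma cluster_ofP r : r \in sublists walk_marks ->
  clusters G P beta al (cluster_of r) <-> connected (size al) r && (r != [::]).
Proof.
rewrite mem_sublists => /mem_subseq sub_r.
have mw := marked_word_cluster_of sub_r.
have -> : (r != [::]) = ((cluster_of r).2 != fset0)%fset.
  congr negb; apply/eqP/eqP => [->|eq0]; first by apply/fsetP => z; rewrite !inE.
  case: r eq0 {sub_r mw} => // x r /fsetP/(_ (embed_mark x)).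
  by rewrite !inE eqxx.
have conP : connected (size al) r <-> ~ (exists d e,
    [/\ marked_word G P beta d, marked_word G P beta e,
        d.1 != [::], e.1 != [::] & cluster_of r = mcat d e]).
  rewrite decomposableP //=; split=> [/allP con [k k_lt noc]|nodec].
    have /hasP[x xr] : has (crosses k) r by apply: con; rewrite mem_iota; lia.
    have := noc (embed_mark x); rewrite inE map_f //= => /(_ isT).
    have [le_x _] := mem_walk_marks (sub_r x xr).
    by rewrite size_factor // -surjective_pairing => /negbTE ->.
  apply/allP => k; rewrite mem_iota => k_lt.
  apply: contrapT => /negP/hasPn noc; apply: nodec; exists k; first by lia.
  move=> z; rewrite inE => /mapP[x xr ->] /=.
  have [le_x _] := mem_walk_marks (sub_r x xr).
  by rewrite size_factor // -surjective_pairing noc.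
split=> [[_ _ c0 /conP->]//|/andP[/conP nodec c0]].
by split.
Qed.

Lemma mk_cluster_of k r : r \in sublists walk_marks ->
  mk G P beta k (cluster_of r) =
  count (pred1 (beta k)) (map (factor (rho al)) r).
Proof.
rewrite mem_sublists => sub_r; have Ur := subseq_uniq sub_r (marks_uniq _ _).
have {}sub_r := mem_subseq sub_r.
rewrite count_map -size_filter -(size_map embed_mark).
set l := map _ _; have Ul : uniq l.
  rewrite map_inj_in_uniq ?filter_uniq // => x y.
  rewrite !mem_filter => /andP[_ /sub_r xm] /andP[_ /sub_r ym].
  exact: embed_mark_inj.
rewrite -(undup_id Ul) -card_fseq /mk; congr (#|` _|)%fset; apply/fsetP => z.
rewrite !inE; apply/andP/mapP => [[/mapP[x xr ->] /asboolP[_ rho_x]]|].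
  by exists x => //; rewrite mem_filter xr andbT -rho_x rho_factor /=.
move=> [x + ->]; rewrite mem_filter => /andP[/eqP eq_b xr]; split.
  exact: map_f.
by apply/asboolP; split; [exact: walks_factor|rewrite rho_factor].
Qed.

Lemma sum_clusters (R : comNzRingType) (t : I -> R) :
  \sum_(c \in clusters G P beta al) tprod t (fun k => mk G P beta k c) =
  \sum_(r <- sublists walk_marks | connected (size al) r && (r != [::]))
     mark_weight (pattern_weight beta t) (rho al) r.
Proof.
have Um : uniq walk_marks := marks_uniq _ _.
pose rs := [seq r <- sublists walk_marks |
            connected (size al) r && (r != [::])].
rewrite (fsbig_seq_support (map cluster_of rs)); first last.
- move=> c clc /mapP[]; have [mw def_al _ _] := clc.
  (* Surjectivity: r collects the marks of the word whose embeddings belong to c. *)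
  pose r := filter (fun x => embed_mark x \in c.2) walk_marks.
  have r_sub : r \in sublists walk_marks by rewrite mem_sublists filter_subseq.
  have def_c : c = cluster_of r.
    rewrite [LHS]surjective_pairing def_al; congr pair; apply/fsetP => z.
    rewrite inE; apply/idP/mapP => [zc|[x + ->]].
      have [zm def_z] := marked_word_marks mw def_al zc.
      by exists (z.1, size z.2); rewrite // mem_filter -def_z zc.
    by rewrite mem_filter => /andP[].
  exists r => //; rewrite mem_filter r_sub andbT; apply/cluster_ofP => //.
  by rewrite -def_c.
- move=> _ /mapP[r + ->]; rewrite mem_filter => /andP[con r_sub] [].
  exact/cluster_ofP.
- rewrite map_inj_in_uniq ?filter_uniq ?sublists_uniq // => r1 r2.
  rewrite !mem_filter !mem_sublists => /andP[_ sub1] /andP[_ sub2] [/fsetP eq_r].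
  rewrite (subseq_uniqP Um sub1) (subseq_uniqP Um sub2).
  apply: eq_in_filter => x xm; have := eq_r (embed_mark x); rewrite !inE.
  have mem_r r : subseq r walk_marks ->
      (embed_mark x \in map embed_mark r) = (x \in r).
    move=> sub_r; apply/mapP/idP => [[y yr]|xr]; last by exists x.
    by move/embed_mark_inj->; rewrite // (mem_subseq sub_r).
  by rewrite !mem_r.
rewrite big_map big_filter big_seq_cond [RHS]big_seq_cond.
apply: eq_bigr => r /andP[r_sub _]; rewrite /mark_weight.
rewrite (tprod_words beta_inj t (bs := map (factor (rho al)) r)) ?big_map //.
by move=> k; rewrite mk_cluster_of.
Qed.

End FixedWalk.

End WalkClusters.

(** * The network series as transfers of word series *)

Section ClusterTheorem.
Variables (A : countType) (I : countType) (beta : I -> seq A).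
Hypothesis beta_inj : injective beta.
Hypothesis beta_size : forall k, (2 <= size (beta k))%N.
Variables (m : nat) (G : rel 'I_m) (P : 'I_m -> 'I_m -> set A).
Variables (R : comNzRingType) (w : A -> 'I_m * 'I_m -> R).
Hypothesis w_out : forall a e, ~ netP G P (a, e) -> w a e = 0.

Definition cluster_gf (t : I -> R) : ncseries A R := fun s =>
  \sum_(r <- sublists (marks (is_pattern beta) s) |
        connected (size s) r && (r != [::]))
     mark_weight (pattern_weight beta t) s r.

(** On words of length at least 2 the empty set of marks is not connected; on a single letter it is
    the only set of marks, since patterns are longer. *)
Lemma connected_gf_patterns t :
  connected_gf (is_pattern beta) (pattern_weight beta t) =
  ((fun s => (size s == 1%N)%:R) : ncseries A R) + cluster_gf t.
Proof.
apply/funext => s; rewrite ncaddE /cluster_gf.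
case: s => [|a [|b s]].
- by rewrite /= big_mkcond big_seq1 addr0.
- rewrite connected_gfE //.
  have -> : marks (is_pattern beta) [:: a] = [::].
    apply: contrapT => /eqP; case def_m: marks => [//|x r] _.
    have := mem_head x r; rewrite -def_m mem_marks.
    case/and3P=> x_gt0 x_le /(is_patternP beta_inj)[u beta_u].
    have := beta_size u; rewrite beta_u size_factor //=.
    by move: x_le => /=; lia.
  rewrite /= big_mkcond big_seq1 [X in _ + X]big_mkcond big_seq1 /=.
  by rewrite /mark_weight big_nil addr0.
- rewrite connected_gfE // add0r; apply: eq_bigl => r.
  by case: r => [|x r]; rewrite ?andbT.
Qed.

Lemma FhatE t : Fhat G P beta w t =
  transfer w (marked_gf (is_pattern beta)
                (pattern_weight beta (fun k => t k - 1))).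
Proof.
apply/matrixP => i j; rewrite !mxE; apply/funext => s.
rewrite marked_gf_patterns // -(sum_walks_between w_out
  (fun s => tprod t (fun k => nb_occ (beta k) s))).
by [].
Qed.

Lemma LhatE t : Lhat G P beta w t = transfer w (cluster_gf t).
Proof.
apply/matrixP => i j; rewrite !mxE; apply/funext => s.
rewrite -(sum_walks_between w_out (cluster_gf t)).
(* Walks with other endpoints contribute 0 to entry (i, j), so the sum narrows to walks from i to
   j. *)
rewrite -(@fsbig_widen _ _ _ _ (walks_between G P i j)); first last.
- move=> al [/= walk_al nbetween]; rewrite !mxE ncmonom_nil_mul.
  case: eqP => [ends_al|]; last by rewrite mulr0.
  by case: nbetween; split=> //; case: al ends_al {walk_al}.
- by move=> al [].
apply: eq_fsbigr => al /set_mem[walk_al between]; rewrite !mxE ncmonom_nil_mul.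
rewrite sum_clusters //.
case: al walk_al between => [|p al] walk_al between.
  (* The empty walk has no [ends], so its matrix is 0; correspondingly [cluster_gf] vanishes on the
     empty word. *)
  rewrite mulr0 /cluster_gf /= big_mkcond big_seq1 /= mulr0.
  by rewrite /ncmonom if_same.
rewrite between eqxx mulrC /ncmonom -[size (p :: al)](size_map fst).
by case: ifP; rewrite ?mul0r.
Qed.

(** The identity holds over any commutative ring with arbitrary values for the t's; indeterminates
    are a special case. *)
Theorem network_cluster_theorem (t : I -> R) :
  let F := Fhat G P beta w t in
  let X := 1%:M - formal_sum (netP G P) (Mletter w)
             - Lhat G P beta w (fun k => t k - 1) in
  F *m X = 1%:M /\ X *m F = 1%:M.
Proof.
move=> F X; pose y := pattern_weight beta (fun k => t k - 1).
pose f := marked_gf (is_pattern beta) y.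
pose g := connected_gf (is_pattern beta) y.
have -> : X = transfer w (1 - g).
  rewrite /X (sum_letters w_out) LhatE -(transfer1 w) -!transferB.
  by rewrite /g connected_gf_patterns opprD addrA.
have -> : F = transfer w f by rewrite /F FhatE.
have gf1 : (1 - g) * f = 1 := marked_connectedE _ _.
rewrite -!transferM gf1 unipotent_left_inverse ?transfer1 //.
exact: marked_gf_nil.
Qed.

End ClusterTheorem.

Theorem theorem5 (A : countType) (K : fieldType) (charK : [pchar K] =i pred0)
    (I : countType) (beta : I -> seq A) (beta_inj : injective beta)
    (beta_size : forall k, (2 <= size (beta k))%N)
    (m : nat) (G : rel 'I_m) (P : 'I_m -> 'I_m -> set A)
    (netGP : monoid_network G P)
    (W : comAlgType K) (w : A -> 'I_m * 'I_m -> W)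
    (w_out : forall a e, ~ netP G P (a, e) -> w a e = 0) :
  let R : comNzRingType := tpoly W I in
  let wR : A -> 'I_m * 'I_m -> R := fun a e => (w a e)%:MP in
  let t : I -> R := fun k => tvar W k in
  let F : 'M[ncseries A R]_m := Fhat G P beta wR t in
  let X : 'M[ncseries A R]_m :=
    1%:M - formal_sum (netP G P) (Mletter wR)
      - Lhat G P beta wR (fun k => t k - 1) in
  F *m X = 1%:M /\ X *m F = 1%:M.
Proof.
move=> R wR t; apply: network_cluster_theorem => // a e nPae.
by rewrite /wR w_out // malgC0E.
Qed.
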